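(* Let $f,\psi_0:\mathbb R^p\to\mathbb R$ be directionally differentiable and such that $\mathbf\Delta_{\psi_0}(\cdot,\gamma)$ is directionally differentiable for every $\gamma$. Let $\mu_0\ge0$, let $\rho_t>0$ ($t\ge0$) be any positive sequence, let $\theta_0\in(0,1]$, and let $\theta_t\in(0,1]$ for $t\ge1$ be determined by $$\frac{\theta_t^2}{1-\theta_t}=\frac{\theta_{t-1}(\rho_{t-1}\theta_{t-1}+\mu_0)}{\rho_t},\qquad t\ge1.$$ Let $\gamma^{(0)}=\beta^{(0)}$ and let the sequences satisfy $$\gamma^{(t)}=\beta^{(t)}+\frac{\rho_{t-1}\theta_t(1-\theta_{t-1})}{\rho_{t-1}\theta_{t-1}+\mu_0}\,(\beta^{(t)}-\beta^{(t-1)}),\quad t\ge1,$$ $$\beta^{(t+1)}\in\mathop{\arg\min}_\beta\ f(\beta)-\mathbf\Delta_{\psi_0}(\beta,\gamma^{(t)})+\mu_0\mathbf D_2(\beta,\gamma^{(t)})+\rho_t\mathbf D_2(\beta,\gamma^{(t)}),\quad t\ge0.$$ Let $\bar\psi_0=\psi_0-\mu_0\|\cdot\|_2^2/2$, $$R_t=(\rho_t\mathbf D_2-\mathbf\Delta_{\bar\psi_0})(\beta^{(t+1)},\gamma^{(t)})+(1-\theta_t)\mathbf\Delta_{\bar\psi_0}(\beta^{(t)},\gamma^{(t)}),$$ $$\mathcal E_t(\beta)=\mathbf\Delta_{\bar\psi_0}(\beta,\gamma^{(t)})+\frac1{\theta_t}\Big\{\mathbf C_{f(\cdot)-\mathbf\Delta_{\psi_0}(\cdot,\gamma^{(t)})}(\beta,\beta^{(t)},\theta_t)+\mathbf\Delta_{f(\cdot)-\mathbf\Delta_{\psi_0}(\cdot,\gamma^{(t)})}(\theta_t\beta+(1-\theta_t)\beta^{(t)},\beta^{(t+1)})\Big\}.$$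 (i) When $\mu_0=0$, for any $\beta$ and $T\ge0$, $$\frac{f(\beta^{(T+1)})-f(\beta)}{\theta_T^2\rho_T}+\sum_{t=0}^T\frac{\mathcal E_t(\beta)}{\theta_t\rho_t}+\sum_{t=0}^T\frac{R_t}{\theta_t^2\rho_t}\le\mathbf D_2(\beta,\beta^{(0)})+\frac{1-\theta_0}{\theta_0^2\rho_0}\big[f(\beta^{(0)})-f(\beta)\big].$$ (ii) Moreover, given any $\mu_0\ge0$, for all $\beta$ and $T\ge0$, $$f(\beta^{(T+1)})-f(\beta)+\theta_T^2\Big(\rho_T+\frac{\mu_0}{\theta_T}\Big)\mathbf D_2\Big(\beta,\frac{\gamma^{(T+1)}-(1-\theta_{T+1})\beta^{(T+1)}}{\theta_{T+1}}\Big)+\sum_{t=0}^T\Big(\prod_{s=t+1}^T(1-\theta_s)\Big)\big(R_t+\theta_t\mathcal E_t(\beta)\big)$$ $$\le\Big(\prod_{t=1}^T(1-\theta_t)\Big)\Big[(1-\theta_0)(f(\beta^{(0)})-f(\beta))+\theta_0^2\rho_0\mathbf D_2(\beta,\beta^{(0)})\Big],$$ where an empty product equals $1$.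
   Context: For $\psi:\mathbb R^p\to\mathbb R$, $\delta\psi(\beta;h)=\lim_{\epsilon\to0+}[\psi(\beta+\epsilon h)-\psi(\beta)]/\epsilon$; $\psi$ is directionally differentiable if this limit exists and is finite for all $\beta,h$. The generalized Bregman function is $\mathbf\Delta_\psi(\beta,\gamma)=\psi(\beta)-\psi(\gamma)-\delta\psi(\gamma;\beta-\gamma)$; $\mathbf\Delta_{f(\cdot)-\mathbf\Delta_{\psi_0}(\cdot,\gamma)}$ is the generalized Bregman function of $\beta\mapsto f(\beta)-\mathbf\Delta_{\psi_0}(\beta,\gamma)$. $\mathbf D_2(\beta,\gamma)=\|\beta-\gamma\|_2^2/2$. For $0\le\theta\le1$, $\mathbf C_\psi(\alpha,\beta,\theta)=\theta\psi(\alpha)+(1-\theta)\psi(\beta)-\psi(\theta\alpha+(1-\theta)\beta)$. No convexity or smoothness is assumed. *)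

(* Defs.v *)
From HB Require Import structures.
From mathcomp Require Import all_boot all_order all_algebra.
From mathcomp Require Import all_classical all_reals all_analysis.

Set Implicit Arguments.
Unset Strict Implicit.
Unset Printing Implicit Defensive.

Import Order.TTheory GRing.Theory Num.Theory.
Import numFieldNormedType.Exports.

Local Open Scope classical_set_scope.
Local Open Scope ring_scope.

Section Bregman.
Context {R : realType} {p : nat}.
Implicit Types (psi f : 'rV[R]_p -> R) (a b c h : 'rV[R]_p).

(* The norm `|x| of MathComp-Analysis on 'rV[R]_p is the sup norm. *)
Definition norm2 b : R := Num.sqrt (\sum_(i < p) b ord0 i ^+ 2).

Definition D2 b c : R := norm2 (b - c) ^+ 2 / 2.

Definition diffquot psi b h (eps : R) : R := (psi (b + eps *: h) - psi b) / eps.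

(* One-sided, unlike the derivative 'D_h psi of the library; meaningful only when
   the quotient converges, cf. dir_differentiable. *)
Definition dirderiv psi b h : R := lim (diffquot psi b h @ 0^'+).

Definition dir_differentiable psi : Prop :=
  forall b h, cvg (diffquot psi b h @ 0^'+).

Definition bregman psi b c : R := psi b - psi c - dirderiv psi c (b - c).

Definition convexity_gap psi a b (theta : R) : R :=
  theta * psi a + (1 - theta) * psi b - psi (theta *: a + (1 - theta) *: b).

Definition is_argmin psi b : Prop := forall c, psi b <= psi c.

Definition surrogate f psi c : 'rV[R]_p -> R := fun b => f b - bregman psi b c.

Definition psi_bar psi (mu : R) : 'rV[R]_p -> R :=
  fun b => psi b - mu * (norm2 b ^+ 2 / 2).

Definition Rterm psi0 (mu0 : R) (rho theta : nat -> R)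
    (beta gamma : nat -> 'rV[R]_p) (t : nat) : R :=
  rho t * D2 (beta t.+1) (gamma t)
  - bregman (psi_bar psi0 mu0) (beta t.+1) (gamma t)
  + (1 - theta t) * bregman (psi_bar psi0 mu0) (beta t) (gamma t).

Definition Eterm f psi0 (mu0 : R) (theta : nat -> R)
    (beta gamma : nat -> 'rV[R]_p) (t : nat) b : R :=
  bregman (psi_bar psi0 mu0) b (gamma t)
  + (theta t)^-1 *
    (convexity_gap (surrogate f psi0 (gamma t)) b (beta t) (theta t)
     + bregman (surrogate f psi0 (gamma t))
         (theta t *: b + (1 - theta t) *: beta t) (beta t.+1)).

End Bregman.

(* Main.v *)
Require Import Defs.
From HB Require Import structures.
From mathcomp Require Import all_boot all_order all_algebra.
From mathcomp Require Import all_classical all_reals all_analysis.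
From mathcomp Require Import ring lra.

Set Implicit Arguments.
Unset Strict Implicit.
Unset Printing Implicit Defensive.

Import Order.TTheory GRing.Theory Num.Theory.
Import numFieldNormedType.Exports.

Local Open Scope ring_scope.

(* Comparing the surrogate objective at its minimiser beta_{t+1} with its value at
   z = theta_t b + (1 - theta_t) beta_t, keeping the Bregman remainder, gives a
   one-step inequality in which rho_t D2(z, gamma_t) = rho_t theta_t^2 D2(b, v_t) for
   v_t = (gamma_t - (1 - theta_t) beta_t) / theta_t.  The extrapolation rule for
   gamma_{t+1} makes v_{t+1} a convex combination of
   (beta_{t+1} - (1 - theta_t) beta_t) / theta_t and beta_t, so the remaining
   quadratics dominate W_t D2(b, v_{t+1}) with W_t = theta_t (rho_t theta_t + mu0).
   The recursion on theta says rho_t theta_t^2 = (1 - theta_t) W_{t-1}, so the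
   one-step inequalities telescope. *)

(** * Bregman functions built from one-sided derivatives, and the quadratic [D2] *)

Section BregmanCalculus.
Local Open Scope classical_set_scope.
Local Open Scope ring_scope.
Context {R : realType} {p : nat}.
Implicit Types (psi phi : 'rV[R]_p -> R) (a b c h : 'rV[R]_p).

Lemma D2E b c : D2 b c = \sum_(i < p) (b ord0 i - c ord0 i) ^+ 2 / 2.
Proof.
rewrite /D2 /norm2 sqr_sqrtr; last by apply: sumr_ge0 => i _; exact: sqr_ge0.
by rewrite mulr_suml; apply: eq_bigr => i _; rewrite !mxE.
Qed.

Lemma D2_ge0 b c : 0 <= D2 b c.
Proof. by rewrite /D2 divr_ge0 // sqr_ge0. Qed.

Lemma D2C b c : D2 b c = D2 c b.
Proof. by rewrite !D2E; apply: eq_bigr => i _; rewrite -sqrrN opprB. Qed.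

Lemma D2_affine (k : R) a b c : D2 (k *: a + c) (k *: b + c) = k ^+ 2 * D2 a b.
Proof.
by rewrite !D2E mulr_sumr; apply: eq_bigr => i _; rewrite !mxE; field.
Qed.

Lemma D2_convex (s : R) a b c :
  D2 (s *: a + (1 - s) *: b) c =
  s * D2 a c + (1 - s) * D2 b c - s * (1 - s) * D2 a b.
Proof.
rewrite !D2E !mulr_sumr -sumrN -!big_split /=.
by apply: eq_bigr => i _; rewrite !mxE; field.
Qed.

Lemma diffquotD psi phi (k : R) b h :
  diffquot (fun x => psi x + k * phi x) b h =
  (fun eps => diffquot psi b h eps + k * diffquot phi b h eps).
Proof. by apply/funext => eps; rewrite /diffquot; ring. Qed.

Lemma dir_differentiableD psi phi (k : R) :
  dir_differentiable psi -> dir_differentiable phi ->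
  dir_differentiable (fun x => psi x + k * phi x).
Proof.
move=> dpsi dphi b h; rewrite diffquotD.
by apply: is_cvgD; [exact: dpsi | apply: is_cvgMl_tmp; exact: dphi].
Qed.

Lemma bregmanD psi phi (k : R) a b :
  dir_differentiable psi -> dir_differentiable phi ->
  bregman (fun x => psi x + k * phi x) a b = bregman psi a b + k * bregman phi a b.
Proof.
move=> dpsi dphi; rewrite /bregman.
suff -> : dirderiv (fun x => psi x + k * phi x) b (a - b) =
    dirderiv psi b (a - b) + k * dirderiv phi b (a - b) by ring.
rewrite /dirderiv diffquotD; apply: cvg_lim => //.
by apply: cvgD; [exact: dpsi | apply: cvgMl_tmp; exact: dphi].
Qed.

(** The point [b + eps *: h] is the combination of [b + h] and [b] with weight [eps], so [D2_convex]
    makes the quotient affine in [eps], with slope [D2 (b + h) b]. *)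
Lemma diffquot_D2_cvg c b h :
  diffquot (fun x => D2 x c) b h @ 0^'+ --> D2 (b + h) c - D2 b c - D2 (b + h) b.
Proof.
have lin : (fun eps : R => D2 (b + h) c - D2 b c - D2 (b + h) b
      + eps * D2 (b + h) b) @ 0^'+ --> D2 (b + h) c - D2 b c - D2 (b + h) b.
  rewrite -[X in _ --> X]addr0 -[X in _ --> _ + X](mul0r (D2 (b + h) b)).
  apply: cvgD; first exact: cvg_cst.
  by apply: cvgMr_tmp; apply: cvg_at_right_filter; exact: cvg_id.
apply: cvg_trans lin; apply: near_eq_cvg; near=> eps.
have eps0 : eps != 0 by rewrite gt_eqF //; near: eps; exact: nbhs_right_gt.
rewrite /diffquot.
have -> : b + eps *: h = eps *: (b + h) + (1 - eps) *: b.
  by apply/rowP => i; rewrite !mxE; ring.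
by rewrite D2_convex; field.
Unshelve. all: by end_near. Qed.

Lemma dir_differentiable_D2 c : dir_differentiable (fun b => D2 b c).
Proof. by move=> b h; apply/cvg_ex; eexists; exact: diffquot_D2_cvg. Qed.

Lemma bregman_D2 c a b : bregman (fun x => D2 x c) a b = D2 a b.
Proof.
rewrite /bregman /dirderiv (cvg_lim _ (@diffquot_D2_cvg c b (a - b))) //.
by rewrite [b + _]addrC subrK; ring.
Qed.

Lemma bregman_psi_bar psi (mu : R) a b :
  dir_differentiable psi ->
  bregman (psi_bar psi mu) a b = bregman psi a b - mu * D2 a b.
Proof.
move=> dpsi; have -> : psi_bar psi mu = fun x => psi x + - mu * D2 x 0.
  by apply/funext => x; rewrite /psi_bar /D2 subr0 mulNr.
rewrite bregmanD ?bregman_D2 ?mulNr //.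
exact: dir_differentiable_D2.
Qed.

(** At a minimiser every one-sided difference quotient is nonnegative, hence so is the directional
    derivative; convexity does not enter. *)
Lemma bregman_argmin psi a b :
  dir_differentiable psi -> is_argmin psi b -> bregman psi a b <= psi a - psi b.
Proof.
move=> dpsi minb; rewrite /bregman gerBl.
apply: limr_ge; first exact: dpsi.
by near=> eps; rewrite /diffquot divr_ge0 ?subr_ge0.
Unshelve. all: by end_near. Qed.

Lemma dir_differentiable_surrogate f psi c :
  dir_differentiable f -> dir_differentiable (fun b => bregman psi b c) ->
  dir_differentiable (surrogate f psi c).
Proof.
move=> df dpsi; have -> : surrogate f psi c = fun b => f b + -1 * bregman psi b c.
  by apply/funext => b; rewrite /surrogate mulN1r.
exact: dir_differentiableD.
Qed.

(** This is [bregman_argmin] for the penalised objective: the Bregman function is additive, and that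
    of [D2 x c] is [D2] itself whatever the centre [c]. *)
Lemma bregman_prox_argmin g (k : R) a b c :
  dir_differentiable g -> is_argmin (fun x => g x + k * D2 x c) b ->
  g b + k * D2 b c + bregman g a b + k * D2 a b <= g a + k * D2 a c.
Proof.
move=> dg minb; have dD := @dir_differentiable_D2 c.
have := bregman_argmin a (dir_differentiableD dg dD) minb.
rewrite bregmanD // bregman_D2; lra.
Qed.

End BregmanCalculus.

(** * The accelerated iteration and its telescoping bounds *)

Section Acceleration.
Context {R : realType} {p : nat}.
Variables (f psi0 : 'rV[R]_p -> R) (mu0 : R) (rho theta : nat -> R).
Variables beta gamma : nat -> 'rV[R]_p.
Hypothesis f_dd : dir_differentiable f.
Hypothesis psi0_dd : dir_differentiable psi0.
Hypothesis breg_dd : forall c, dir_differentiable (fun b => bregman psi0 b c).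
Hypothesis mu0_ge0 : 0 <= mu0.
Hypothesis rho_gt0 : forall t, 0 < rho t.
Hypothesis theta_bnd : forall t, 0 < theta t <= 1.
Hypothesis theta_rec : forall t, (1 <= t)%N ->
  theta t ^+ 2 / (1 - theta t) =
  theta t.-1 * (rho t.-1 * theta t.-1 + mu0) / rho t.
Hypothesis gamma0 : gamma 0%N = beta 0%N.
Hypothesis gamma_rec : forall t, (1 <= t)%N ->
  gamma t = beta t +
    (rho t.-1 * theta t * (1 - theta t.-1) /
     (rho t.-1 * theta t.-1 + mu0)) *: (beta t - beta t.-1).
Hypothesis beta_rec : forall t,
  is_argmin (fun b => f b - bregman psi0 b (gamma t)
                      + mu0 * D2 b (gamma t) + rho t * D2 b (gamma t))
            (beta t.+1).

(** Chosen so that [gamma t] is [theta t *: v t + (1 - theta t) *: beta t]. *)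
Let v t := (theta t)^-1 *: (gamma t - (1 - theta t) *: beta t).
Let W t := theta t * (rho t * theta t + mu0).
Let Rt := Rterm psi0 mu0 rho theta beta gamma.
Let Et := Eterm f psi0 mu0 theta beta gamma.

Lemma theta_gt0 t : 0 < theta t.
Proof. by case/andP: (theta_bnd t). Qed.

Lemma theta_le1 t : theta t <= 1.
Proof. by case/andP: (theta_bnd t). Qed.

Lemma rho_theta_mu_gt0 t : 0 < rho t * theta t + mu0.
Proof. by rewrite ltr_wpDr // mulr_gt0 // theta_gt0. Qed.

Lemma weight_gt0 t : 0 < W t.
Proof. by rewrite mulr_gt0 ?theta_gt0 ?rho_theta_mu_gt0. Qed.

(* If theta_{t+1} were 1, the recursion would read 0 = W_t / rho_{t+1}, as x / 0 = 0. *)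
Lemma theta_lt1 t : theta t.+1 < 1.
Proof.
rewrite lt_neqAle theta_le1 andbT; apply/eqP => th1.
have := theta_rec (ltn0Sn t); rewrite th1 subrr invr0 mulr0 /= => /esym/eqP.
by rewrite gt_eqF // divr_gt0 // weight_gt0.
Qed.

Lemma weight_rec t : rho t.+1 * theta t.+1 ^+ 2 = (1 - theta t.+1) * W t.
Proof.
have r0 : rho t.+1 != 0 by rewrite gt_eqF.
have th0 : 1 - theta t.+1 != 0 by rewrite gt_eqF // subr_gt0 theta_lt1.
have /(congr1 (fun x => x * (rho t.+1 * (1 - theta t.+1)))) := theta_rec (ltn0Sn t).
by rewrite /= -/(W t) => e; apply: etrans (etrans e _); field.
Qed.

Lemma v0 : v 0%N = beta 0%N.
Proof.
have := theta_gt0 0; rewrite /v gamma0 => /lt0r_neq0 th0.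
by apply/rowP => i; rewrite !mxE; field.
Qed.

Lemma dist_v_le t b :
  W t * D2 b (v t.+1) <=
  (mu0 + rho t) * D2 (theta t *: b + (1 - theta t) *: beta t) (beta t.+1)
  + mu0 * (theta t * (1 - theta t)) * D2 b (beta t).
Proof.
have th0 := theta_gt0 t; have w0 := rho_theta_mu_gt0 t.
have th'0 := theta_gt0 t.+1; have r0 := rho_gt0 t; have th1 := theta_le1 t.
set u := (theta t)^-1 *: (beta t.+1 - (1 - theta t) *: beta t).
(* Substituting [beta t.+1 - beta t = theta t *: (u - beta t)] into the extrapolation rule gives
   [v t.+1 = beta t + s *: (u - beta t)] for exactly this [s]. *)
set s := (mu0 + rho t) * theta t / (rho t * theta t + mu0).
have thn := lt0r_neq0 th0; have wn := lt0r_neq0 w0; have thn' := lt0r_neq0 th'0.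
have -> : v t.+1 = s *: u + (1 - s) *: beta t.
  rewrite /v gamma_rec //=; apply/rowP => i; rewrite !mxE /s.
  by field; rewrite wn thn thn'.
have -> : beta t.+1 = theta t *: u + (1 - theta t) *: beta t.
  by rewrite /u scalerA divff // scale1r subrK.
rewrite D2_affine D2C D2_convex (D2C u) (D2C (beta t) b).
have s0 : 0 <= s by rewrite divr_ge0 ?(ltW w0) // mulr_ge0 ?(ltW th0) // addr_ge0 // ltW.
have s1 : 0 <= 1 - s.
  have -> : 1 - s = mu0 * (1 - theta t) / (rho t * theta t + mu0) by rewrite /s; field.
  by rewrite divr_ge0 ?(ltW w0) // mulr_ge0 // subr_ge0.
(* This is the only slack in the lemma: the cross term of [D2_convex], which is dropped. *)
have ge0 : 0 <= W t * (s * (1 - s) * D2 u (beta t)).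
  apply: mulr_ge0; first exact: ltW (weight_gt0 t).
  by apply: mulr_ge0 (D2_ge0 _ _); exact: mulr_ge0.
rewrite mulrBr lerBlDr.
(* The weights match since [W t * s = (mu0 + rho t) * theta t ^+ 2] and [W t * (1 - s) = mu0 * theta
   t * (1 - theta t)]. *)
have -> : W t * (s * D2 b u + (1 - s) * D2 b (beta t)) =
  (mu0 + rho t) * (theta t ^+ 2 * D2 b u) +
  mu0 * (theta t * (1 - theta t)) * D2 b (beta t).
  by rewrite /W /s; field.
by rewrite lerDl.
Qed.

Lemma one_step t b :
  f (beta t.+1) - f b + W t * D2 b (v t.+1) + (Rt t + theta t * Et t b) <=
  (1 - theta t) * (f (beta t) - f b) + rho t * theta t ^+ 2 * D2 b (v t).
Proof.
have thn := lt0r_neq0 (theta_gt0 t).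
set z := theta t *: b + (1 - theta t) *: beta t.
have := dist_v_le t b; rewrite -/z => Hv.
(* The points [z] and [gamma t] are the images of [b] and [v t] under one affine map of ratio
   [theta t]. *)
have Dz : theta t ^+ 2 * D2 b (v t) = D2 z (gamma t).
  by rewrite -(D2_affine _ _ _ ((1 - theta t) *: beta t)) /v scalerA divff // scale1r subrK.
have Dz' := D2_convex (theta t) b (beta t) (gamma t); rewrite -/z in Dz'.
have dg := dir_differentiable_surrogate f_dd (@breg_dd (gamma t)).
have minb : is_argmin (fun x => surrogate f psi0 (gamma t) x
    + (mu0 + rho t) * D2 x (gamma t)) (beta t.+1).
  by move=> c; have := beta_rec t c; rewrite /surrogate !mulrDl !addrA.
have := bregman_prox_argmin z dg minb.
have -> : theta t * Et t b = theta t * bregman (psi_bar psi0 mu0) b (gamma t)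
    + (convexity_gap (surrogate f psi0 (gamma t)) b (beta t) (theta t)
       + bregman (surrogate f psi0 (gamma t)) z (beta t.+1)).
  by rewrite /Et /Eterm -/z; field.
rewrite -[rho t * _ * _]mulrA Dz /Rt /Rterm /convexity_gap -/z !bregman_psi_bar //.
set B := bregman (surrogate _ _ _) _ _.
rewrite /surrogate.
move: Hv Dz'.
set d1 := D2 z (beta _); set d2 := D2 b (beta _); set d3 := D2 z (gamma _).
move=> Hv Dz' Hm.
(* Expanding [mu0 * D2 z (gamma t)] yields the [mu0] corrections carried by [psi_bar] in [Rt] and
   [Et], and its cross term cancels the last term of [dist_v_le]. *)
have := congr1 (fun x => mu0 * x) Dz'; lra.
Qed.

Lemma accelerated_bound b T :
  f (beta T.+1) - f b + W T * D2 b (v T.+1)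
  + \sum_(0 <= t < T.+1)
      (\prod_(t.+1 <= s < T.+1) (1 - theta s)) * (Rt t + theta t * Et t b)
  <= (\prod_(1 <= t < T.+1) (1 - theta t))
     * ((1 - theta 0%N) * (f (beta 0%N) - f b)
        + theta 0%N ^+ 2 * rho 0%N * D2 b (beta 0%N)).
Proof.
elim: T => [|T IH].
  (* No earlier weight exists at time 0, so [rho 0 * theta 0 ^+ 2] stays and [v0] identifies the
     centre. *)
  by have := one_step 0 b; rewrite v0 big_nat1 !big_geq // !mul1r [theta 0%N ^+ 2 * _]mulrC.
rewrite [leRHS](_ : _ = (1 - theta T.+1) * ((\prod_(1 <= t < T.+1) (1 - theta t))
   * ((1 - theta 0%N) * (f (beta 0%N) - f b)
        + theta 0%N ^+ 2 * rho 0%N * D2 b (beta 0%N)))); last first.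
  by rewrite (@big_nat_recr _ _ _ T.+1) //=; ring.
have th1 : 0 <= 1 - theta T.+1 by rewrite subr_ge0 theta_le1.
apply: le_trans (ler_wpM2l th1 IH).
(* The newest summand has an empty product; every older one gains the factor [1 - theta T.+1], which
   matches the scaled induction hypothesis. *)
rewrite big_nat_recr //= (@big_geq _ _ _ T.+2) // mul1r.
rewrite (eq_big_nat _ _ (F2 := fun t => (1 - theta T.+1) *
  ((\prod_(t.+1 <= s < T.+1) (1 - theta s)) * (Rt t + theta t * Et t b)))); last first.
  by move=> t /andP[_ tT]; rewrite big_nat_recr //= mulrA [(1 - _) * _]mulrC.
rewrite -mulr_sumr.
have := one_step T.+1 b; rewrite weight_rec.
set S := \sum_(_ <= _ < _) _.
lra.
Qed.

(** Dividing [one_step] by [W t] gives the distances coefficient 1, so they telescope. The term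
    [D2 b (v T.+1)] is kept because the induction needs it. *)
Lemma accelerated_bound_mu0 b T : mu0 = 0 ->
  (f (beta T.+1) - f b) / (theta T ^+ 2 * rho T) + D2 b (v T.+1)
  + \sum_(0 <= t < T.+1) Et t b / (theta t * rho t)
  + \sum_(0 <= t < T.+1) Rt t / (theta t ^+ 2 * rho t)
  <= D2 b (beta 0%N)
     + (1 - theta 0%N) / (theta 0%N ^+ 2 * rho 0%N) * (f (beta 0%N) - f b).
Proof.
move=> mu00.
have WE t : W t = theta t ^+ 2 * rho t by rewrite /W mu00 addr0; ring.
have step t : (f (beta t.+1) - f b) / W t + D2 b (v t.+1)
    + Et t b / (theta t * rho t) + Rt t / W t <=
    (1 - theta t) / W t * (f (beta t) - f b) + D2 b (v t).
  have w0 := weight_gt0 t.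
  have thn := lt0r_neq0 (theta_gt0 t); have rn := lt0r_neq0 (rho_gt0 t).
  rewrite -(ler_pM2l w0); apply: le_trans (le_trans (one_step t b) _).
    by rewrite WE le_eqVlt; apply/orP; left; apply/eqP; field; rewrite thn rn.
  by rewrite WE le_eqVlt; apply/orP; left; apply/eqP; field; rewrite thn rn.
elim: T => [|T IH].
  by have := step 0%N; rewrite v0 !big_nat1 WE; lra.
rewrite !(@big_nat_recr _ _ _ T.+1) //=.
have := step T.+1; rewrite WE.
(* By [weight_rec] the incoming coefficient of the gap in [f] equals the outgoing one of the
   previous step. *)
have -> : (1 - theta T.+1) / (theta T.+1 ^+ 2 * rho T.+1) = (theta T ^+ 2 * rho T)^-1.
  have th1 : 1 - theta T.+1 != 0 by rewrite gt_eqF // subr_gt0 theta_lt1.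
  have Wn : W T != 0 by rewrite lt0r_neq0 // weight_gt0.
  by rewrite [_ * rho T.+1]mulrC weight_rec -WE; field; rewrite Wn th1.
lra.
Qed.

End Acceleration.

Theorem theorem7 (R : realType) (p : nat) (f psi0 : 'rV[R]_p -> R)
    (f_dd : dir_differentiable f)
    (psi0_dd : dir_differentiable psi0)
    (breg_dd : forall c : 'rV[R]_p,
       dir_differentiable (fun b => bregman psi0 b c))
    (mu0 : R) (mu0_ge0 : 0 <= mu0)
    (rho theta : nat -> R)
    (rho_gt0 : forall t : nat, 0 < rho t)
    (theta_bnd : forall t : nat, 0 < theta t <= 1)
    (theta_rec : forall t : nat, (1 <= t)%N ->
       theta t ^+ 2 / (1 - theta t) =
       theta t.-1 * (rho t.-1 * theta t.-1 + mu0) / rho t)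
    (beta gamma : nat -> 'rV[R]_p)
    (gamma0 : gamma 0%N = beta 0%N)
    (gamma_rec : forall t : nat, (1 <= t)%N ->
       gamma t = beta t +
         (rho t.-1 * theta t * (1 - theta t.-1) /
          (rho t.-1 * theta t.-1 + mu0)) *: (beta t - beta t.-1))
    (beta_rec : forall t : nat,
       is_argmin (fun b => f b - bregman psi0 b (gamma t)
                           + mu0 * D2 b (gamma t) + rho t * D2 b (gamma t))
                 (beta t.+1)) :
  (mu0 = 0 ->
   forall (b : 'rV[R]_p) (T : nat),
     (f (beta T.+1) - f b) / (theta T ^+ 2 * rho T)
     + \sum_(0 <= t < T.+1)
         Eterm f psi0 mu0 theta beta gamma t b / (theta t * rho t)
     + \sum_(0 <= t < T.+1)
         Rterm psi0 mu0 rho theta beta gamma t / (theta t ^+ 2 * rho t)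
     <= D2 b (beta 0%N)
        + (1 - theta 0%N) / (theta 0%N ^+ 2 * rho 0%N) * (f (beta 0%N) - f b))
  /\
  (forall (b : 'rV[R]_p) (T : nat),
     f (beta T.+1) - f b
     + theta T ^+ 2 * (rho T + mu0 / theta T)
       * D2 b ((theta T.+1)^-1 *:
                 (gamma T.+1 - (1 - theta T.+1) *: beta T.+1))
     + \sum_(0 <= t < T.+1)
         (\prod_(t.+1 <= s < T.+1) (1 - theta s))
         * (Rterm psi0 mu0 rho theta beta gamma t
            + theta t * Eterm f psi0 mu0 theta beta gamma t b)
     <= (\prod_(1 <= t < T.+1) (1 - theta t))
        * ((1 - theta 0%N) * (f (beta 0%N) - f b)
           + theta 0%N ^+ 2 * rho 0%N * D2 b (beta 0%N))).
Proof.
have thn T : theta T != 0 by case/andP: (theta_bnd T) => /lt0r_neq0.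
split=> [mu00 b T|b T].
  have := accelerated_bound_mu0 f_dd psi0_dd breg_dd mu0_ge0 rho_gt0 theta_bnd
    theta_rec gamma0 gamma_rec beta_rec b T mu00.
  apply: le_trans.
  (* The final distance to [v T.+1] is discarded here. *)
  rewrite !lerD2r lerDl; exact: D2_ge0.
have := accelerated_bound f_dd psi0_dd breg_dd mu0_ge0 rho_gt0 theta_bnd
  theta_rec gamma0 gamma_rec beta_rec b T.
have -> // : theta T * (rho T * theta T + mu0) = theta T ^+ 2 * (rho T + mu0 / theta T).
by field.
Qed.
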